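(* There is a deterministic LOCAL algorithm that computes a hypergraph sinkless orientation in any $n$-node multihypergraph with minimum degree $\delta$ and maximum rank $r<\delta$ in $O(\log_{\delta/r} n)$ rounds.
   Context: A multihypergraph has a multiset of hyperedges (parallel copies are distinct). The degree of a vertex is the number of hyperedges containing it; the rank of a hyperedge is its number of vertices. A hypergraph sinkless orientation (HSO) orients each hyperedge so that it is outgoing for exactly one of its vertices and incoming for all others, such that every vertex has at least one outgoing hyperedge. LOCAL on a hypergraph $G$ means the LOCAL model run on its bipartite representation (vertices of $G$ on one side, hyperedges on the other, vertex $v$ adjacent to hyperedge $e$ iff $v\in e$): nodes have unique IDs, communicate in synchronous rounds with unbounded local computation and unbounded message size; the running time is the number of rounds until all outputs are fixed.
   Formalization: The round bound is read as O(max(1, log_{δ/r} n)): with many parallel hyperedges δ/r can exceed every power of n, so the literal bound would demand 0 rounds, which is impossible already for two vertices joined by rank-2 hyperedges. *)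

(* Defs.v *)
From HB Require Import structures.
From mathcomp Require Import all_boot all_order all_algebra.
From mathcomp Require Import reals exp.

Set Implicit Arguments.
Unset Strict Implicit.
Unset Printing Implicit Defensive.

(* Parallel hyperedges are distinct elements of [hedge] with the same [ends].
   Hyperedges are nonempty: an empty one could not be outgoing for one of its
   vertices. *)
Record multihypergraph := MultiHypergraph {
  vert : finType;
  hedge : finType;
  ends : hedge -> {set vert};
  ends_neq0 : forall e, ends e != set0
}.

Section Hypergraphs.
Variable G : multihypergraph.

Definition degree (v : vert G) : nat := #|[set e : hedge G | v \in ends e]|.

Definition hrank (e : hedge G) : nat := #|ends e|.

Definition is_min_degree (d : nat) : Prop :=
  (forall v, d <= degree v) /\ (exists v, degree v = d).

Definition is_max_rank (r : nat) : Prop :=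
  (forall e, hrank e <= r) /\ (exists e, hrank e = r).

(* [out v e] reads "e is outgoing for v"; it is only meaningful for v \in e,
   where [~~ out v e] reads "e is incoming for v". *)
Definition is_HSO (out : vert G -> hedge G -> bool) : Prop :=
  (forall e, #|[set v in ends e | out v e]| = 1) /\
  (forall v, exists e, v \in ends e /\ out v e).

Definition bip_node : finType := (vert G + hedge G)%type.

Definition bip_adj : rel bip_node := fun x y =>
  match x, y with
  | inl v, inr e | inr e, inl v => v \in ends e
  | _, _ => false
  end.

End Hypergraphs.

(* A deterministic synchronous message-passing algorithm.  A node starts from
   its identifier, its local input and its number of ports; it has no global
   knowledge.  [send s i] is the message sent through port i, and [recv] gets
   the incoming messages listed in port order. *)
Record local_algorithm (In Out : Type) := LocalAlgorithm {
  state : Type;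
  message : Type;
  init : nat -> In -> nat -> state;
  send : state -> nat -> message;
  recv : state -> seq message -> state;
  decide : state -> option Out
}.

Definition port_numbering (V : finType) (adj : rel V) (p : V -> seq V) : Prop :=
  forall x, uniq (p x) /\ p x =i adj x.

Section Execution.
Variables (In Out : Type) (A : local_algorithm In Out).
Variables (V : finType) (p : V -> seq V) (id : V -> nat) (input : V -> In).

Fixpoint state_after (t : nat) : V -> state A :=
  match t with
  | 0 => fun x => init A (id x) (input x) (size (p x))
  | t'.+1 => fun x =>
      recv (state_after t' x)
        [seq send (state_after t' y) (index x (p y)) | y <- p x]
  end.

(* The output fixed after T rounds: the first decision made in rounds 0..T, so
   that an output can never be revised. *)
Definition output_within (T : nat) (x : V) : option Out :=
  ohead (pmap (fun t => decide (state_after t x)) (iota 0 T.+1)).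

End Execution.

Variant side := VertexSide | HyperedgeSide.

Definition bip_side (G : multihypergraph) (x : bip_node G) : side :=
  if x is inl _ then VertexSide else HyperedgeSide.

Definition bip_out (G : multihypergraph) (out : vert G -> hedge G -> bool)
    (x y : bip_node G) : bool :=
  match x, y with
  | inl v, inr e | inr e, inl v => out v e
  | _, _ => false
  end.

(* Every node, vertex or hyperedge, outputs one bit per port: whether the
   hyperedge is outgoing for the vertex in that incidence. *)
Definition computes_HSO_within (A : local_algorithm side (seq bool))
    (G : multihypergraph) (p : bip_node G -> seq (bip_node G))
    (id : bip_node G -> nat) (T : nat) : Prop :=
  exists out : vert G -> hedge G -> bool,
    is_HSO out /\
    forall x, output_within A p id (@bip_side G) T x
              = Some [seq bip_out out x y | y <- p x].

Definition logb (R : realType) (b x : R) : R := (ln x / ln b)%R.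

(* Main.v *)
(** Call an injective assignment of hyperedges to the vertices of a set W, each
    vertex receiving one of its own hyperedges and all the hyperedges used lying
    inside W, a closed matching.  Let T exceed log_{delta/r} n.  A vertex v is
    covered by every maximal closed matching (W, f) using hyperedges of the
    T-ball of v: otherwise explore the hypergraph from v outside W.  The
    hyperedges F met in a step number at least delta/r times the current
    vertices, and if #|F| >= #|V(F) \ W| a minimal such subset of F could be
    matched by Hall's theorem and added to (W, f); hence the layers grow by a
    factor delta/r at every step, beyond n vertices.

    Every node c thus fixes, for each radius s, a largest closed matching of its
    s-ball, and every vertex takes its hyperedge from the one with the least
    (s, id c) that covers it.  Two vertices taking the same hyperedge are, by
    closedness, covered by each other's matchings, so they use the same one and
    are equal. *)
Require Import Defs.
From mathcomp Require Import all_boot all_order all_algebra.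
From mathcomp Require Import boolp reals exp.
From mathcomp Require Import zify lra.

Set Implicit Arguments.
Unset Strict Implicit.
Unset Printing Implicit Defensive.

(** * Hall's marriage theorem *)

Section Hall.
Variables X Y : finType.
Implicit Types (A B : {set X}) (N : X -> {set Y}).

(** Induction on [#|A|]. A tight proper subset [B] splits the problem into [B] and [A :\: B] with
    the neighbours of [B] removed; if no nonempty proper subset is tight, any [x] may take any
    neighbour [y], since the slack pays for the loss of [y]. The value [y0] serves the case of an
    empty [A]. *)
Theorem hall A N (y0 : Y) :
    (forall B, B \subset A -> #|B| <= #|\bigcup_(x in B) N x|) ->
  exists2 f : X -> Y, {in A &, injective f} & {in A, forall x, f x \in N x}.
Proof.
have [k] := ubnP #|A|; elim: k A N => // k IH A N; rewrite ltnS => leAk hallA.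
have [->|/set0Pn[x xA]] := eqVneq A set0.
  by exists (fun=> y0) => x; rewrite inE.
have ltD B : B \proper A -> #|B| < k by move/proper_card/leq_trans; apply.
case: (pickP [pred B : {set X} | [&& B \proper A, B != set0 &
         #|\bigcup_(x in B) N x| <= #|B|]]) => [B /and3P[pBA B0 tightB]|slack].
- set NB := \bigcup_(x in B) N x in tightB.
  have sBA := proper_sub pBA.
  have [||f fI fN] := IH B N; first exact: ltD.
    by move=> C sCB; apply: hallA; apply: subset_trans sBA.
  have [||g gI gN] := IH (A :\: B) (fun x => N x :\: NB).
  + apply: ltD; rewrite properE subsetDl; apply/subsetPn.
    have /set0Pn[z zB] := B0; exists z; first exact: (subsetP sBA).
    by rewrite inE zB.
  + move=> C sC.
    have dCB : [disjoint C & B].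
      by move: sC; rewrite subsetD => /andP[].
    have := hallA (C :|: B); rewrite subUset sBA andbT.
    move/(_ (subset_trans sC (subsetDl _ _))).
    rewrite cardsU disjoint_setI0 // cards0 subn0 => leU.
    have : #|\bigcup_(x in C :|: B) N x| <=
           #|\bigcup_(x in C) (N x :\: NB)| + #|NB|.
      apply: leq_trans (leq_card_setU _ _); apply: subset_leq_card.
      apply/bigcupsP => z; rewrite inE => zCB; apply/subsetP => y yNz.
      rewrite inE; have [yB|yB] := boolP (y \in NB); first by rewrite orbT.
      rewrite orbF; apply/bigcupP; exists z; last by rewrite inE yB.
      case/orP: zCB => // zB; case/negP: yB; apply/bigcupP; by exists z.
    lia.
  have gB z : z \in A -> z \notin B -> g z \in N z :\: NB.
    by move=> zA zB; apply: gN; rewrite inE zB.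
  have fB z : z \in B -> f z \in NB.
    by move=> zB; apply/bigcupP; exists z => //; apply: fN.
  exists (fun z => if z \in B then f z else g z).
  + move=> z w zA wA; case: ifPn => zB; case: ifPn => wB E.
    * exact: fI.
    * by have := gB w wA wB; rewrite -E inE fB.
    * by have := gB z zA zB; rewrite E inE fB.
    * by apply: gI => //; rewrite inE ?zB ?wB.
  + move=> z zA; case: ifPn => zB; first exact: fN.
    by have := gB z zA zB; rewrite inE => /andP[].
- have /card_gt0P[y yNx] : 0 < #|N x|.
    by have := hallA [set x]; rewrite sub1set big_set1 cards1; apply.
  have pA : A :\ x \proper A by rewrite properD1.
  have [||g gI gN] := IH (A :\ x) (fun z => N z :\ y); first exact: ltD.
    move=> B sB; have [->|B0] := eqVneq B set0; first by rewrite cards0.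
    have := slack B; rewrite /= B0 (sub_proper_trans sB pA) /=.
    move/negbT; rewrite -ltnNge => ltB.
    have : #|\bigcup_(z in B) N z| <= #|\bigcup_(z in B) (N z :\ y)| + #|[set y]|.
      apply: leq_trans (leq_card_setU _ _); apply: subset_leq_card.
      apply/bigcupsP => z zB; apply/subsetP => w wNz; rewrite !inE.
      have [|wy] := eqVneq w y; first by rewrite orbT.
      by rewrite orbF; apply/bigcupP; exists z; rewrite // !inE wy.
    rewrite cards1; lia.
  have gy z : z \in A -> z != x -> (g z != y) && (g z \in N z).
    by move=> zA zx; have := gN z; rewrite !inE zx; apply.
  exists (fun z => if z == x then y else g z).
  + move=> z w zA wA; case: eqP => [->|/eqP zx]; case: eqP => [->|/eqP wx] //.
    * by move=> E; have := gy w wA wx; rewrite -E eqxx.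
    * by move=> E; have := gy z zA zx; rewrite E eqxx.
    * by apply: gI; rewrite !inE ?zx ?wx.
  + by move=> z zA; case: eqP => [->//|/eqP zx]; case/andP: (gy z zA zx).
Qed.

End Hall.

(** * Growth of the hypergraph outside a vertex set *)

Section Expansion.
Variable G : multihypergraph.
Implicit Types (W X : {set vert G}) (F : {set hedge G}).

Definition span W F : {set vert G} := \bigcup_(e in F) ends e :\: W.

(* A minimal nonempty F with #|span W F| <= #|F| satisfies Hall's condition
   from span W F to F. *)
Lemma dense_matching W F :
    F != set0 -> {in F, forall e, ~~ (ends e \subset W)} ->
    #|span W F| <= #|F| ->
  exists X (g : vert G -> hedge G),
    [/\ X != set0, [disjoint X & W], {in X &, injective g} &
      {in X, forall u, [/\ g u \in F, u \in ends (g u) &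
                           ends (g u) \subset X :|: W]}].
Proof.
have [k] := ubnP #|F|; elim: k F => // k IH F; rewrite ltnS => leFk F0 FW dense.
case: (pickP [pred F' : {set hedge G} | [&& F' \proper F, F' != set0 &
         #|span W F'| <= #|F'|]]) => [F' /and3P[pF' F'0 dense']|sparse].
  have sF' := subsetP (proper_sub pF').
  have [||X [g [X0 XW gI gF]]] := IH F' _ F'0 _ dense'.
  - exact: leq_trans (proper_card pF') leFk.
  - by move=> e /sF'; apply: FW.
  exists X, g; split=> // u /gF[/sF' ? ? ?]; by split.
have /set0Pn[e0 e0F] := F0.
pose N (u : vert G) := [set e in F | u \in ends e].
have [|g gI gN] := @hall _ _ (span W F) N e0.
  move=> B sB; have [->|B0] := eqVneq B set0; first by rewrite cards0.
  (* Dropping the hyperedges that meet [B] removes all of [B] from the span. As [F'] is sparse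
     unless empty, [#|F| - #|N(B)| < #|span W F| - #|B|], which with the density of [F] is Hall's
     condition for [B]. *)
  pose F' := F :\: \bigcup_(u in B) N u.
  have sN : \bigcup_(u in B) N u \subset F.
    by apply/bigcupsP => u _; apply/subsetP => e; rewrite inE => /andP[].
  have cF' : #|F'| = #|F| - #|\bigcup_(u in B) N u| by rewrite cardsDS.
  have leN := subset_leq_card sN.
  have leB := subset_leq_card sB.
  have [F'0|F'0] := eqVneq F' set0.
    by move: cF'; rewrite F'0 cards0; lia.
  have pF' : F' \proper F.
    have /set0Pn[u uB] := B0.
    have := subsetP sB _ uB; rewrite inE => /andP[uW /bigcupP[e eF ue]].
    rewrite properE subsetDl; apply/subsetPn; exists e => //.
    rewrite inE eF andbT negbK; apply/bigcupP; exists u => //.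
    by rewrite inE eF.
  have := sparse F'; rewrite /= pF' F'0 /= => /negbT; rewrite -ltnNge => ltF'.
  have : #|span W F'| <= #|span W F :\: B|.
    apply/subset_leq_card/subsetP => u; rewrite inE => /andP[uW].
    case/bigcupP => e; rewrite inE => /andP[eN eF] ue.
    rewrite inE inE uW; apply/andP; split; last by apply/bigcupP; exists e.
    apply: contra eN => uB; apply/bigcupP; exists u => //; by rewrite inE eF.
  rewrite cardsDS //; lia.
exists (span W F), g; split=> //.
- have /subsetPn[u ue uW] := FW _ e0F.
  by apply/set0Pn; exists u; rewrite inE uW; apply/bigcupP; exists e0.
- by rewrite -setI_eq0; apply/eqP/setP => u; rewrite !inE andbC; case: (u \in W).
- move=> u /gN; rewrite inE => /andP[gF ug]; split=> //.
  apply/subsetP => w wg; rewrite inE inE; case: (w \in W) => //=.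
  by rewrite orbF; apply/bigcupP; exists (g u).
Qed.

(** These are balls rather than spheres: a vertex of a layer outside [W] with at least one hyperedge
    stays in the next layer, so the size of a single layer measures the growth. *)
Fixpoint layer W (v : vert G) (j : nat) : {set vert G} :=
  if j is i.+1
  then span W [set e : hedge G | ~~ [disjoint ends e & layer W v i]]
  else [set v].

Lemma layer_disjoint W v j : v \notin W -> [disjoint layer W v j & W].
Proof.
move=> vW; case: j => [|j]; first by rewrite disjoints1.
by rewrite -setI_eq0; apply/eqP/setP => u; rewrite !inE andbC; case: (u \in W).
Qed.

(** Double counting of the incidences with [S]: at least [delta] per vertex, at most [r] per
    hyperedge. *)
Lemma incidence_bound (S : {set vert G}) delta r :
    (forall v : vert G, delta <= degree v) -> (forall e : hedge G, hrank e <= r) ->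
  delta * #|S| <= r * #|[set e : hedge G | ~~ [disjoint ends e & S]]|.
Proof.
move=> degG rkG; set F := [set e | _].
have -> : delta * #|S| = \sum_(v in S) delta by rewrite sum_nat_const mulnC.
have -> : r * #|F| = \sum_(e in F) r by rewrite sum_nat_const mulnC.
apply: (@leq_trans (\sum_(v in S) \sum_(e in F | v \in ends e) 1)).
  apply: leq_sum => v vS; apply: leq_trans (degG v) _.
  rewrite sum1_card /degree; apply: subset_leq_card; apply/subsetP => e.
  rewrite inE => ve; rewrite unfold_in /= ve andbT inE -setI_eq0.
  by apply/set0Pn; exists v; rewrite inE ve.
rewrite (exchange_big_dep (mem F)) /=; last by move=> v e _ /andP[].
apply: leq_sum => e eF; rewrite sum1_card; apply: leq_trans (rkG e).
by apply: subset_leq_card; apply/subsetP => v; rewrite unfold_in => /and3P[].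
Qed.

(** The bound on [T] says [T > log_{delta/r} #|vert G|] without division. If no layer yields a dense
    set of hyperedges, each layer outnumbers the hyperedges meeting the previous one, and by
    [incidence_bound] layer [T] has more vertices than exist. *)
Lemma exists_relative_matching W v delta r T :
    (forall v : vert G, delta <= degree v) -> (forall e : hedge G, hrank e <= r) ->
    0 < delta -> r ^ T * #|vert G| < delta ^ T -> v \notin W ->
  exists X (g : vert G -> hedge G),
    [/\ X != set0, [disjoint X & W], {in X &, injective g} &
      {in X, forall u, [/\ exists2 j, j < T & ~~ [disjoint ends (g u) & layer W v j],
                           u \in ends (g u) & ends (g u) \subset X :|: W]}].
Proof.
move=> degG rkG delta0 ltT vW; apply: contrapT => noX.
have growth j : j <= T -> delta ^ j <= r ^ j * #|layer W v j|.
  elim: j => [|j IH] ltj; first by rewrite !expn0 cards1.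
  have {}IH := IH (ltnW ltj).
  set F := [set e : hedge G | ~~ [disjoint ends e & layer W v j]].
  have count := incidence_bound (layer W v j) degG rkG; rewrite -/F in count.
  suff ltF : #|F| < #|layer W v j.+1|.
    rewrite !expnS; set a := delta ^ j in IH *; set b := r ^ j in IH *.
    apply: (@leq_trans (delta * (b * #|layer W v j|))); first by rewrite leq_mul.
    rewrite mulnCA [r * b]mulnC -mulnA leq_mul //; apply: leq_trans count _.
    by rewrite leq_mul // ltnW.
  rewrite ltnNge; apply/negP => dense; apply: noX.
  have [||X [g [X0 XW gI gF]]] := @dense_matching W F _ _ dense.
  - apply/eqP => F0; move: count; rewrite F0 cards0 muln0 leqn0 muln_eq0.
    case/orP => [|/eqP c0]; first by rewrite eqn0Ngt delta0.
    move: IH; rewrite c0 muln0 leqn0 expn_eq0; lia.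
  - move=> e; rewrite inE -setI_eq0 => /set0Pn[u]; rewrite inE => /andP[ue ul].
    apply/subsetPn; exists u => //.
    by rewrite (disjointFr (layer_disjoint j vW) ul).
  exists X, g; split=> // u /gF[]; rewrite inE => ? ? ?; split=> //.
  by exists j.
have := growth T (leqnn _); rewrite leqNgt => /negP; apply.
by apply: leq_ltn_trans ltT; rewrite leq_mul // max_card.
Qed.

End Expansion.

(** * The algorithm *)

(* The identifier of a hyperedge and the identifiers of its vertices. *)
Definition hrec := (nat * seq nat)%type.

(* A token (s, i, K): node i knew exactly the hyperedge records K at time s. *)
Definition token := (nat * nat * seq hrec)%type.

(** Phrased with identifiers only, so that a node can evaluate it on the records it holds. The
    matched set is the domain of the partial map [m]. *)
Definition closed_matching (K : seq hrec) (m : nat -> option hrec) : Prop :=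
  (forall i e, m i = Some e ->
     [/\ e \in K, i \in e.2 & {in e.2, forall j, isSome (m j)}]) /\
  (forall i j e, m i = Some e -> m j = Some e -> i = j).

Definition covered (K : seq hrec) (m : nat -> option hrec) : nat :=
  count (fun i => isSome (m i)) (undup (flatten (map snd K))).

Definition is_largest_matching K m :=
  closed_matching K m /\
  forall m', closed_matching K m' -> covered K m' <= covered K m.

Lemma exists_largest_matching K : exists m, is_largest_matching K m.
Proof.
pose P c := `[< exists2 m, closed_matching K m & covered K m = c >].
have exP : exists c, P c.
  by exists (covered K (fun=> None)); apply/asboolP; exists (fun=> None).
have ubP c : P c -> c <= size (undup (flatten (map snd K))).
  by move/asboolP => [m _ <-]; apply: count_size.
case: (ex_maxnP exP ubP) => c /asboolP[m mK <-] max.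
exists m; split=> // m' m'K; apply: max; apply/asboolP; by exists m'.
Qed.

(** The choice depends on [K] alone, so all nodes holding the same token use the same matching
    without further communication. *)
Definition largest_matching K : nat -> option hrec :=
  sval (cid (exists_largest_matching K)).

Lemma largest_matchingP K : is_largest_matching K (largest_matching K).
Proof. by rewrite /largest_matching; case: cid. Qed.

(** Largest by count implies maximal by inclusion, the form in which an augmentation contradicts
    it. *)
Lemma largest_matching_ext K m' i :
    closed_matching K m' ->
    (forall j, isSome (largest_matching K j) -> isSome (m' j)) ->
  isSome (m' i) -> isSome (largest_matching K i).
Proof.
move=> m'K sub m'i; have [_ /(_ m' m'K)] := largest_matchingP K.
rewrite leqNgt; apply: contraNT => mi; rewrite /covered.
set s := undup _.
have is_s : i \in s.
  move: m'i; case E: (m' i) => [e|//] _; have [eK ie _] := m'K.1 _ _ E.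
  by rewrite mem_undup; apply/flattenP; exists e.2 => //; apply: map_f.
have /permP eqs := perm_to_rem is_s.
rewrite !eqs /= m'i (negbTE mi) add0n add1n ltnS.
by apply: sub_count => j; apply: sub.
Qed.

(** Each message is the sender's whole state, so a neighbour's [grab] and [owner] are recomputed
    from it, one round late. *)
Record hso_state := HSOState {
  clock : nat;
  self : nat;
  part : side;
  nbrs : seq nat;
  known : seq hrec;
  tokens : seq token;
  nbr_grabs : seq (option nat);
  nbr_owners : seq (option nat)
}.

Definition token_le : rel token := fun a b =>
  (a.1.1 < b.1.1) || (a.1.1 == b.1.1) && (a.1.2 <= b.1.2).

(* The level-s tokens relevant to a vertex have all reached it by time
   2s + 2, so that a least candidate is never superseded. *)
Definition candidates (st : hso_state) : seq token :=
  [seq tk <- tokens st | (2 * tk.1.1 + 2 <= clock st) &&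
                         isSome (largest_matching tk.2 (self st))].

Definition grab (st : hso_state) : option nat :=
  if sort token_le (candidates st) is tk :: _
  then omap fst (largest_matching tk.2 (self st)) else None.

(* A hyperedge that nobody grabs goes to the vertex at its first port. *)
Definition owner (st : hso_state) : option nat :=
  if (0 < clock st) && all isSome (nbr_grabs st)
  then Some (nth (head 0 (nbrs st)) (nbrs st)
                 (index (Some (self st)) (nbr_grabs st)))
  else None.

Definition hso_init (i : nat) (s : side) (d : nat) : hso_state :=
  HSOState 0 i s [::] [::] [::] [::] [::].

(** A hyperedge can form its own record only after hearing its vertices' identifiers. The new token
    freezes what was known before the round. *)
Definition hso_recv (st : hso_state) (ms : seq hso_state) : hso_state :=
  HSOState (clock st).+1 (self st) (part st) (map self ms)
    ((if part st is HyperedgeSide then [:: (self st, map self ms)] else [::])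
       ++ known st ++ flatten (map known ms))
    ((clock st, self st, known st) :: tokens st ++ flatten (map tokens ms))
    (map grab ms) (map owner ms).

Definition hso_decide (st : hso_state) : option (seq bool) :=
  match part st with
  | HyperedgeSide =>
      omap (fun o => [seq o == i | i <- nbrs st]) (owner st)
  | VertexSide =>
      if (0 < clock st) && all isSome (nbr_owners st)
      then Some [seq o == Some (self st) | o <- nbr_owners st] else None
  end.

Definition hso_algorithm : local_algorithm side (seq bool) :=
  LocalAlgorithm hso_init (fun st _ => st) hso_recv hso_decide.

Lemma token_le_total : total token_le.
Proof. by move=> a b; rewrite /token_le; lia. Qed.

Lemma token_le_trans : transitive token_le.
Proof. by move=> b a c; rewrite /token_le; lia. Qed.

Lemma grabP st : candidates st != [::] ->
  exists tk, [/\ tk \in candidates st,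
                 {in candidates st, forall tk', token_le tk tk'} &
                 grab st = omap fst (largest_matching tk.2 (self st))].
Proof.
move=> c0; rewrite /grab; have := mem_sort token_le (candidates st).
have := sort_sorted token_le_total (candidates st).
case: (sort _ _) => [|tk s] /= srt mem_s.
  by case: (candidates st) c0 mem_s => // a s _ /(_ a); rewrite !inE eqxx.
exists tk; split=> //; first by rewrite -mem_s inE eqxx.
move=> tk'; rewrite -mem_s inE => /orP[/eqP ->|].
  by rewrite /token_le eqxx leqnn orbT.
by move: tk'; apply/allP; apply: order_path_min srt; exact: token_le_trans.
Qed.

Lemma all_isSome_map (I : eqType) (T : Type) (s : seq I) (f : I -> option T)
    (g : I -> T) :
    {in s, forall i, f i = Some (g i) \/ f i = None} ->
  all isSome [seq f i | i <- s] -> [seq f i | i <- s] = [seq Some (g i) | i <- s].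
Proof.
move=> fg; rewrite all_map => /allP fS; apply/eq_in_map => i is_.
by have := fS i is_; case: (fg i is_) => /= ->.
Qed.

Lemma ohead_pmap_iota (O : Type) (d : nat -> option O) T o :
    (forall t, d t = Some o \/ d t = None) -> d T = Some o ->
  ohead (pmap d (iota 0 T.+1)) = Some o.
Proof.
move=> sound fin.
have : exists2 t, t \in iota 0 T.+1 & d t = Some o.
  by exists T; rewrite // mem_iota ltnSn.
elim: (iota _ _) => [[]//|t s IH] [t' + dt'] /=.
case: (sound t) => dt; rewrite dt //= inE => /orP[/eqP E|t's].
  by rewrite E dt in dt'.
by apply: IH; exists t'.
Qed.

(** * Flow of records and tokens in an execution *)

Section Run.
Variables (G : multihypergraph) (p : bip_node G -> seq (bip_node G)).
Variable id : bip_node G -> nat.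
Hypothesis p_port : port_numbering (@bip_adj G) p.
Hypothesis id_inj : injective id.

Local Notation st := (state_after hso_algorithm p id (@bip_side G)).

Definition record_of (e : hedge G) : hrec :=
  (id (inr e), [seq id y | y <- p (inr e)]).

Lemma mem_port_edge e y :
  y \in p (inr e) -> exists2 v, y = inl v & v \in ends e.
Proof.
have [_ ->] := p_port (inr e); case: y => [v|e'] //= ve; by exists v.
Qed.

Lemma mem_port_vertex v y :
  y \in p (inl v) -> exists2 e, y = inr e & v \in ends e.
Proof.
have [_ ->] := p_port (inl v); case: y => [w|e] //= ve; by exists e.
Qed.

Lemma port_edge e v : (inl v \in p (inr e)) = (v \in ends e).
Proof. by have [_ ->] := p_port (inr e). Qed.

Lemma port_vertex e v : (inr e \in p (inl v)) = (v \in ends e).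
Proof. by have [_ ->] := p_port (inl v). Qed.

Lemma port_sym x y : (x \in p y) = (y \in p x).
Proof.
have [_ ->] := p_port y; have [_ ->] := p_port x.
by case: x y => [v|e] [w|f].
Qed.

Lemma mem_record e v : (id (inl v) \in (record_of e).2) = (v \in ends e).
Proof. by rewrite /record_of /= mem_map // port_edge. Qed.

Lemma mem_recordP e i :
  i \in (record_of e).2 -> exists2 v, i = id (inl v) & v \in ends e.
Proof.
by case/mapP => y /mem_port_edge[v -> ve] ->; exists v.
Qed.

Lemma edge_id_inj e e' : id (inr e) = id (inr e') -> e = e'.
Proof. by move/id_inj => -[]. Qed.

Lemma clock_st t x : clock (st t x) = t.
Proof. by elim: t => //= t ->. Qed.

Lemma self_st t x : self (st t x) = id x.
Proof. by elim: t. Qed.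

Lemma part_st t x : part (st t x) = bip_side x.
Proof. by elim: t. Qed.

Lemma nbrs_st t x : nbrs (st t.+1 x) = [seq id y | y <- p x].
Proof.
by rewrite /= -map_comp; apply: eq_map => y /=; rewrite self_st.
Qed.

Lemma known_st t x :
  known (st t.+1 x) = (if x is inr e then [:: record_of e] else [::])
    ++ known (st t x) ++ flatten [seq known (st t y) | y <- p x].
Proof.
rewrite /= part_st self_st -!map_comp; congr (_ ++ _); case: x => //= e.
by congr [:: (_, _)]; apply: eq_map => y /=; rewrite self_st.
Qed.

Lemma tokens_st t x :
  tokens (st t.+1 x) = (t, id x, known (st t x)) ::
    tokens (st t x) ++ flatten [seq tokens (st t y) | y <- p x].
Proof. by rewrite /= clock_st self_st -!map_comp. Qed.

Lemma known_step t x y R :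
  y \in p x -> R \in known (st t y) -> R \in known (st t.+1 x).
Proof.
move=> yx Ry; rewrite known_st !mem_cat; apply/orP; right; apply/orP; right.
by apply/flattenP; exists (known (st t y)) => //; apply: map_f.
Qed.

Lemma known_mono t t' x R :
  t <= t' -> R \in known (st t x) -> R \in known (st t' x).
Proof.
move=> /subnK <-; elim: (t' - t) => // k IH /IH Rk.
by rewrite addSn known_st !mem_cat Rk orbT.
Qed.

Lemma tokens_step t x y tk :
  y \in p x -> tk \in tokens (st t y) -> tk \in tokens (st t.+1 x).
Proof.
move=> yx Ry; rewrite tokens_st inE mem_cat; apply/orP; right; apply/orP; right.
by apply/flattenP; exists (tokens (st t y)) => //; apply: map_f.
Qed.

Lemma tokens_mono t t' x tk :
  t <= t' -> tk \in tokens (st t x) -> tk \in tokens (st t' x).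
Proof.
move=> /subnK <-; elim: (t' - t) => // k IH /IH Rk.
by rewrite addSn tokens_st inE mem_cat Rk orbT.
Qed.

Lemma known_sound t x R : R \in known (st t x) -> exists e, R = record_of e.
Proof.
elim: t x => // t IH x; rewrite known_st !mem_cat => /or3P[|/IH//|].
  by case: x => // e; rewrite inE => /eqP ->; exists e.
by case/flattenP => _ /mapP[y _ ->] /IH.
Qed.

Lemma tokens_sound t x tk :
  tk \in tokens (st t x) ->
  exists c, tk = (tk.1.1, id c, known (st tk.1.1 c)).
Proof.
elim: t x => // t IH x; rewrite tokens_st inE mem_cat => /or3P[/eqP ->|/IH//|].
  by exists x.
by case/flattenP => _ /mapP[y _ ->] /IH.
Qed.

(** Only [e] creates [record_of e]; the path that brought it to [x] within [s] rounds also carries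
    whatever [e] knows at time [a]. *)
Lemma known_trans s a x e R :
  record_of e \in known (st s x) -> R \in known (st a (inr e)) ->
  R \in known (st (a + s) x).
Proof.
move=> + Ra; elim: s x => // s IH x; rewrite known_st !mem_cat => /or3P[|/IH|].
- case: x => // e'; rewrite inE => /eqP[/edge_id_inj ee' _].
  by rewrite -ee'; apply: known_mono Ra; rewrite leq_addr.
- by apply: known_mono; rewrite addnS.
- case/flattenP => _ /mapP[y yx ->] /IH; rewrite addnS; exact: known_step.
Qed.

(** The path followed by the record of [e] is traversed backwards, as adjacency is symmetric. *)
Lemma tokens_back s a x e tk :
  record_of e \in known (st s x) -> tk \in tokens (st a x) ->
  tk \in tokens (st (a + s) (inr e)).
Proof.
elim: s a x => // s IH a x; rewrite known_st !mem_cat => /or3P[|/IH{}IH|].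
- case: x => // e'; rewrite inE => /eqP[/edge_id_inj -> _].
  by apply: tokens_mono; rewrite leq_addr.
- by move/IH; apply: tokens_mono; rewrite addnS.
- case/flattenP => _ /mapP[y yx ->] ey tka; rewrite addnS -addSn.
  by apply: IH ey _; apply: tokens_step tka; rewrite port_sym.
Qed.

Lemma known_incident e v : v \in ends e -> record_of e \in known (st 2 (inl v)).
Proof.
move=> ve; apply: (@known_step 1 _ (inr e)); first by rewrite port_vertex.
by rewrite known_st inE eqxx.
Qed.

(** Three rounds per layer: the record of [e] forms at [e], moves to [u], then to the hyperedge [f]
    that brought [u] into the layer; the record of [f] reaches [v] by induction. *)
Lemma known_layer W v j u e :
  u \in layer W v j -> u \in ends e ->
  record_of e \in known (st (3 * j + 2) (inl v)).
Proof.
elim: j u e => [|j IH] u e.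
  by rewrite inE => /eqP ->; apply: known_incident.
rewrite (_ : 3 * j.+1 + 2 = 3 + (3 * j + 2)); last by lia.
rewrite inE => /andP[_ /bigcupP[f]]; rewrite inE -setI_eq0.
case/set0Pn => w; rewrite inE => /andP[wf wl] uf ue.
apply: (known_trans (IH _ _ wl wf)).
apply: (@known_step 2 _ (inl u)); first by rewrite port_edge.
exact: known_incident.
Qed.

(** * Every vertex is covered by the matching of its own ball *)

Lemma largest_matching_known t x i R :
    largest_matching (known (st t x)) i = Some R ->
  exists e v, [/\ R = record_of e, record_of e \in known (st t x),
                  i = id (inl v) & v \in ends e].
Proof.
move=> mR; have [[cl _] _] := largest_matchingP (known (st t x)).
have [RK iR _] := cl _ _ mR; have [e Re] := known_sound RK.
move: RK iR; rewrite Re => RK /mem_recordP[v -> ve]; by exists e, v.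
Qed.

Lemma largest_matching_ball v delta r T :
    (forall v : vert G, delta <= degree v) -> (forall e : hedge G, hrank e <= r) ->
    0 < delta -> r ^ T * #|vert G| < delta ^ T ->
  isSome (largest_matching (known (st (3 * T) (inl v))) (id (inl v))).
Proof.
move=> degG rkG delta0 ltT; apply: contraT => v0.
set K := known _ in v0 *; have [[mK mI] _] := largest_matchingP K.
pose W := [set u | isSome (largest_matching K (id (inl u)))].
have vW : v \notin W by rewrite inE.
(* The hyperedges of [g] meet a layer [j < T], so their records are known by time
   [3 * j + 2 < 3 * T] and [g] can extend the matching. *)
have [X [g [X0 XW gI gX]]] := exists_relative_matching degG rkG delta0 ltT vW.
pose ext i := [pick u in X | id (inl u) == i].
pose m' i := if largest_matching K i is Some R then Some R
             else omap (fun u => record_of (g u)) (ext i).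
have extP i R : omap (fun u => record_of (g u)) (ext i) = Some R ->
    exists u, [/\ u \in X, i = id (inl u) & R = record_of (g u)].
  rewrite /ext; case: pickP => //= u /andP[uX /eqP <-] [<-]; by exists u.
have extT u : u \in X -> isSome (ext (id (inl u))).
  by move=> uX; rewrite /ext; case: pickP => // /(_ u); rewrite uX eqxx.
have m'Some j : isSome (largest_matching K j) -> isSome (m' j).
  by rewrite /m'; case: (largest_matching K j).
have m'X u : u \in X -> isSome (m' (id (inl u))).
  move=> /extT; rewrite /m'; case: (largest_matching K _) => //.
  by case: (ext _).
have m'K : closed_matching K m'.
  split=> [i R|i j R].
    rewrite /m'; case Ei: (largest_matching K i) => [R'|].
      move=> [<-]; have [RK iR cl] := mK _ _ Ei; split=> // j jR.
      exact/m'Some/cl.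
    move=> /extP[u [uX -> ->]]; have [[j ltj] hit uR sub] := gX _ uX.
    split; rewrite ?mem_record //.
      move: hit; rewrite -setI_eq0 => /set0Pn[w]; rewrite inE => /andP[wg wl].
      by apply: known_mono (known_layer wl wg); lia.
    move=> j' /mem_recordP[w -> /(subsetP sub)]; rewrite inE => /orP[/m'X//|].
    by rewrite inE => /m'Some.
  rewrite /m'; case Ei: (largest_matching K i) => [Ri|];
    case Ej: (largest_matching K j) => [Rj|].
  - by move=> [Ri_] [Rj_]; apply: mI Ei _; rewrite Ej Ri_ Rj_.
  (* If [g u] were already used by the old matching, closedness would make that matching cover [u],
     which [Ej] denies. *)
  - move=> [<-] /extP[u [uX ju Ru]]; have [_ uR _] := gX _ uX.
    have [_ _ /(_ j)] := mK _ _ Ei.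
    by rewrite Ru ju mem_record uR -ju Ej => /(_ isT).
  - move=> /extP[u [uX iu Ru]] [Rj_]; have [_ uR _] := gX _ uX.
    have [_ _ /(_ i)] := mK _ _ Ej.
    by rewrite Rj_ Ru iu mem_record uR -iu Ei => /(_ isT).
  - move=> /extP[u [uX -> ->]] /extP[w [wX -> [/edge_id_inj E _]]].
    by rewrite (gI _ _ uX wX E).
have /set0Pn[u uX] := X0.
have := largest_matching_ext m'K m'Some (m'X _ uX).
have -> : isSome (largest_matching K (id (inl u))) = (u \in W) by rewrite inE.
by rewrite (disjointFr XW uX).
Qed.

(** * Least tokens and the stability of grabs *)

Definition valid_token v (tk : token) : Prop :=
  (exists c, tk = (tk.1.1, id c, known (st tk.1.1 c))) /\
  isSome (largest_matching tk.2 (id (inl v))).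

(** Minimality ranges over tokens of all times, arrived or not, so it does not depend on the
    round. *)
Definition is_least_token v tk :=
  valid_token v tk /\ forall tk', valid_token v tk' -> token_le tk tk'.

Lemma exists_least_token v tk :
  valid_token v tk -> exists tk0, is_least_token v tk0 /\ tk0.1.1 <= tk.1.1.
Proof.
move=> vtk.
pose P s := `[< exists2 tk, valid_token v tk & tk.1.1 = s >].
have exP : exists s, P s by exists tk.1.1; apply/asboolP; exists tk.
case: (ex_minnP exP) => s /asboolP[tk1 vtk1 tk1s] mins.
pose Q i := `[< exists2 tk, valid_token v tk & tk.1 = (s, i) >].
have exQ : exists i, Q i.
  by exists tk1.1.2; apply/asboolP; exists tk1; rewrite // -tk1s -surjective_pairing.
case: (ex_minnP exQ) => i /asboolP[tk0 vtk0 tk0si] mini.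
exists tk0; split; last first.
  by rewrite tk0si; apply: mins; apply/asboolP; exists tk.
split=> // tk' vtk'; rewrite /token_le tk0si /=.
have : s <= tk'.1.1 by apply: mins; apply/asboolP; exists tk'.
rewrite leq_eqVlt => /orP[/eqP E|-> //]; rewrite E eqxx ltnn /=.
by apply: mini; apply/asboolP; exists tk'; rewrite // E -surjective_pairing.
Qed.

(** The token of time [s] exists at [s.+1]. Its records include the hyperedge matched to [v], so it
    goes back to that hyperedge in [s] rounds and to [v] in one more. *)
Lemma valid_token_arrives v tk t :
  valid_token v tk -> 2 * tk.1.1 + 2 <= t -> tk \in tokens (st t (inl v)).
Proof.
case=> -[c ->] /= cov let_; set s := tk.1.1 in cov let_ *.
case E: (largest_matching _ _) cov => [R|//] _.
have [e [u [Re eK /id_inj[vu] ve]]] := largest_matching_known E.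
rewrite -vu in ve; apply: tokens_mono let_ _.
have -> : 2 * s + 2 = (s.+1 + s).+1 by lia.
apply: (@tokens_step _ _ (inr e)); first by rewrite port_vertex.
by apply: tokens_back eK _; rewrite tokens_st inE eqxx.
Qed.

Lemma candidate_valid v t tk :
  tk \in candidates (st t (inl v)) ->
  valid_token v tk /\ 2 * tk.1.1 + 2 <= t.
Proof.
rewrite mem_filter clock_st self_st => /andP[/andP[lt_ cov]].
by move/tokens_sound.
Qed.

(** Although [token_le] ignores the records, these are determined by the time and the node, and
    identifiers are injective. *)
Lemma valid_token_eq v w tk tk' :
  valid_token v tk -> valid_token w tk' ->
  token_le tk tk' -> token_le tk' tk -> tk = tk'.
Proof.
move=> [[c Ec] _] [[c' Ec'] _]; rewrite Ec Ec' /token_le /= => le1 le2.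
have Es : tk.1.1 = tk'.1.1 by lia.
have /id_inj -> : id c = id c' by lia.
by rewrite Es.
Qed.

(** Before the deadline a candidate would be a valid token of earlier time than the least one; from
    then on the least token is present. Hence a grab, once made, never changes. *)
Lemma grab_st v tk t : is_least_token v tk ->
  grab (st t (inl v)) =
    if 2 * tk.1.1 + 2 <= t then omap fst (largest_matching tk.2 (id (inl v)))
    else None.
Proof.
move=> [vtk least]; case: ifPn => let_.
  have tkC : tk \in candidates (st t (inl v)).
    by rewrite mem_filter clock_st self_st let_ vtk.2 valid_token_arrives.
  have [|tk' [tk'C min ->]] := @grabP (st t (inl v)).
    by apply: contraTneq tkC => ->.
  have [vtk' _] := candidate_valid tk'C.
  by rewrite self_st -(valid_token_eq vtk vtk' (least _ vtk') (min _ tkC)).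
rewrite /grab; suff -> : candidates (st t (inl v)) = [::] by [].
case E: (candidates _) => [//|tk' s].
have [|vtk' lt'] := @candidate_valid v t tk'; first by rewrite E inE eqxx.
exfalso; move: let_ lt' (least _ vtk'); rewrite /token_le.
move: tk.1.1 tk'.1.1 (_ <= tk'.1.2) => a b c; lia.
Qed.

Lemma nbr_grabs_st t x : nbr_grabs (st t.+1 x) = [seq grab (st t y) | y <- p x].
Proof. by rewrite /= -map_comp. Qed.

Lemma nbr_owners_st t x :
  nbr_owners (st t.+1 x) = [seq owner (st t y) | y <- p x].
Proof. by rewrite /= -map_comp. Qed.

(** Least tokens have time at most [3 * T], so grabs are fixed by round [6 * T + 2]; hyperedges read
    them one round later and vertices learn the owners in the next. *)
Lemma hso_within delta r T :
    (forall v : vert G, delta <= degree v) -> (forall e : hedge G, hrank e <= r) ->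
    0 < delta -> r ^ T * #|vert G| < delta ^ T ->
  computes_HSO_within hso_algorithm p id (6 * T + 4).
Proof.
move=> degG rkG delta0 ltT.
have exL v : exists tk, is_least_token v tk /\ tk.1.1 <= 3 * T.
  pose tk0 : token := (3 * T, id (inl v), known (st (3 * T) (inl v))).
  apply: (@exists_least_token v tk0); split; first by exists (inl v).
  exact: largest_matching_ball degG rkG delta0 ltT.
have [tk tkP] := choice exL.
pose g v := oapp fst 0 (largest_matching (tk v).2 (id (inl v))).
have gE v : exists e, [/\ g v = id (inr e), v \in ends e &
    largest_matching (tk v).2 (id (inl v)) = Some (record_of e)].
  have [[[[c Ec] cov] _] _] := tkP v; rewrite /g.
  case E: (largest_matching _ _) cov => [R|//] _.
  move: (E); rewrite {1}Ec /= => /largest_matching_known[e [u [-> _]]].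
  by move=> /id_inj[->] ue; exists e.
have grabE t v : grab (st t (inl v)) =
    if 2 * (tk v).1.1 + 2 <= t then Some (g v) else None.
  rewrite (grab_st _ (tkP v).1); case: ifP => // _; rewrite /g.
  by have [e [_ _ ->]] := gE v.
(* Both vertices are covered by both tokens, as matchings are closed. *)
have g_inj v w : g v = g w -> v = w.
  have [e [-> ve mv]] := gE v; have [e' [-> we mw]] := gE w.
  move=> /edge_id_inj ee'; rewrite -ee' in we mw.
  have [[vtk leastv] _] := tkP v; have [[wtk leastw] _] := tkP w.
  have [[clv injv] _] := largest_matchingP (tk v).2.
  have [[clw _] _] := largest_matchingP (tk w).2.
  have vw : valid_token v (tk w).
    split; first exact: wtk.1.
    by have [_ _] := clw _ _ mw; apply; rewrite mem_record.
  have wv : valid_token w (tk v).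
    split; first exact: vtk.1.
    by have [_ _] := clv _ _ mv; apply; rewrite mem_record.
  have E := valid_token_eq vtk wtk (leastv _ vw) (leastw _ wv).
  by rewrite -E in mw; have /id_inj[] := injv _ _ _ mv mw.
pose gn (y : bip_node G) := if y is inl v then g v else 0.
pose ids e := [seq id y | y <- p (inr e)].
pose own e := nth (head 0 (ids e)) (ids e)
                  (index (Some (id (inr e))) [seq Some (gn y) | y <- p (inr e)]).
have ownS t e : owner (st t (inr e)) = Some (own e) \/
                owner (st t (inr e)) = None.
  case: t => [|t]; first by right.
  rewrite /owner clock_st self_st nbrs_st nbr_grabs_st /=.
  case: ifP => [|_]; last by right.
  move/(@all_isSome_map _ _ _ _ gn) => -> ; first by left.
  move=> y /mem_port_edge[v -> _]; rewrite grabE /=.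
  by case: ifP => _; [left|right].
have ownT t e : 6 * T + 3 <= t -> owner (st t (inr e)) = Some (own e).
  case: (ownS t e) => // + let_; case: t let_ => [|t] let_; first by lia.
  rewrite /owner clock_st nbr_grabs_st /=; case: ifP => // /negP[].
  apply/allP => _ /mapP[_ /mem_port_edge[v -> _] ->]; rewrite grabE.
  by have [_ les] := tkP v; case: ifP => //; lia.
have own_mem e : exists2 v, v \in ends e & own e = id (inl v).
  (* Nonemptiness makes the default [head 0 (ids e)] a real vertex of [e] when nobody grabs it. *)
  have /set0Pn[v0 v0e] := ends_neq0 e.
  suff /mapP[_ /mem_port_edge[v -> ve] ->] : own e \in ids e by exists v.
  rewrite /own; set j := index _ _.
  have : 0 < size (ids e).
    by rewrite size_map lt0n size_eq0; apply: contraTneq v0e; rewrite -port_edge => ->.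
  have [ltj _|lej] := ltnP j (size (ids e)); first exact: mem_nth.
  by rewrite nth_default //; case: (ids e) => //= a s; rewrite inE eqxx.
have own_grab v e : g v = id (inr e) -> v \in ends e -> own e = id (inl v).
  move=> gv ve; rewrite /own; set s := [seq Some (gn y) | y <- _].
  have es : Some (id (inr e)) \in s.
    by apply/mapP; exists (inl v); rewrite ?port_edge //= gv.
  have ltj : index (Some (id (inr e))) s < size (p (inr e)).
    by move: es; rewrite -index_mem size_map.
  (* The first port reporting a grab of [e] belongs to [v], because [g] is injective. *)
  have := nth_index None es; rewrite /s (nth_map (inl v)) // -/s.
  rewrite /ids (nth_map (inl v)) //; set y := nth _ _ _ => -[].
  have /mem_port_edge[w -> _] : y \in p (inr e) by apply: mem_nth.
  by rewrite /= -gv => /g_inj ->.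
exists (fun v e => own e == id (inl v)); split; first split.
- move=> e; have [v ve ov] := own_mem e; rewrite -(cards1 v); congr #|pred_of_set _|.
  apply/setP => w; rewrite !inE ov (inj_eq id_inj).
  by rewrite (inj_eq (@inl_inj _ _)) eq_sym; case: eqP => [->|_]; rewrite ?ve ?andbF.
- move=> v; have [e [gv ve _]] := gE v; exists e; split=> //.
  by apply/eqP; apply: own_grab.
(* At every round a decision is either absent or already final, so the first one agrees with that of
   round [6 * T + 4]. *)
- move=> x; apply: (@ohead_pmap_iota _ (fun t => hso_decide (st t x))).
  + case: x => [v|e] t; rewrite /hso_decide part_st /=; last first.
      case: t => [|t]; first by right.
      case: (ownS t.+1 e) => ->; [left|by right].
      rewrite nbrs_st /= -map_comp; congr Some; apply/eq_in_map => y /=.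
      by move=> /mem_port_edge[v ->].
    case: t => [|t]; first by right.
    rewrite clock_st self_st nbr_owners_st /=; case: ifP => [|_]; last by right.
    pose on (y : bip_node G) := if y is inr e then own e else 0.
    move/(@all_isSome_map _ _ _ _ on) => -> ; last first.
      by move=> y /mem_port_vertex[e -> _]; apply: ownS.
    left; rewrite -map_comp; congr Some; apply/eq_in_map => y /=.
    by move=> /mem_port_vertex[e ->].
  + case: x => [v|e]; rewrite /hso_decide part_st /=; last first.
      rewrite ownT; last by lia.
      rewrite addn4 nbrs_st /= -map_comp; congr Some; apply/eq_in_map => y /=.
      by move=> /mem_port_edge[v ->].
    rewrite addn4 clock_st self_st nbr_owners_st.
    have -> : [seq owner (st (6 * T).+3 y) | y <- p (inl v)] =
        [seq Some (if y is inr e then own e else 0) | y <- p (inl v)].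
      apply/eq_in_map => y /mem_port_vertex[e -> _]; apply: ownT; lia.
    have -> (s : seq (bip_node G)) (f : bip_node G -> nat) :
      all isSome [seq Some (f y) | y <- s] by elim: s.
    rewrite /= -map_comp; congr Some; apply/eq_in_map => y /=.
    by move=> /mem_port_vertex[e ->].
Qed.

End Run.

(** * The logarithmic round bound *)

Import Order.TTheory GRing.Theory Num.Theory.

Theorem theorem1p6 (R : realType) :
  exists (A : local_algorithm side (seq bool)) (C : R),
  forall (G : multihypergraph) (n delta r : nat),
    #|vert G| = n ->
    is_min_degree G delta ->
    is_max_rank G r ->
    (r < delta)%N ->
    forall (p : bip_node G -> seq (bip_node G)) (id : bip_node G -> nat),
      port_numbering (@bip_adj G) p ->
      injective id ->
      exists T : nat,
        (T%:R <= C * Num.max 1 (logb (delta%:R / r%:R) n%:R))%R /\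
        computes_HSO_within A p id T.
Proof.
(* With [T = truncn L + 1] the rounds number [6 * truncn L + 10], at most [16 * L] since
   [1 <= L]. *)
exists hso_algorithm, 16%:R%R.
move=> G n delta r cardG [degG [v0 _]] [rkG [e0 rk0]] ltr p id p_port id_inj.
have r0 : (0 < r)%N by rewrite -rk0 /hrank card_gt0 ends_neq0.
have n0 : (0 < n)%N by rewrite -cardG; apply/card_gt0P; exists v0.
have delta0 : (0 < delta)%N by apply: leq_ltn_trans ltr.
pose b : R := (delta%:R / r%:R)%R.
have b0 : (0 < b)%R by rewrite divr_gt0 // ltr0n.
have b1 : (1 < b)%R by rewrite ltr_pdivlMr ?ltr0n // mul1r ltr_nat.
set L := Num.max _ _.
have L1 : (1 <= L)%R by rewrite /L le_max lexx.
pose T := (Num.truncn L).+1.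
exists (6 * T + 4)%N; split.
  have : ((Num.truncn L)%:R <= L)%R by rewrite truncn_le; apply: le_trans L1.
  rewrite natrD natrM /T -natr1; lra.
apply: (hso_within p_port id_inj degG rkG delta0).
(* Over the reals the condition becomes [n < b ^ T]; taking logarithms leaves [ln n / ln b < T],
   which holds as [L < T]. *)
rewrite cardG -(ltr_nat R) natrM !natrX.
rewrite mulrC -ltr_pdivlMr ?exprn_gt0 ?ltr0n // -expr_div_n -/b.
rewrite -ltr_ln ?posrE ?exprn_gt0 ?ltr0n // lnXn // -[(ln b *+ _)%R]mulr_natl.
rewrite -ltr_pdivrMr ?ln_gt0 //.
apply: le_lt_trans (truncnS_gt L).
by rewrite /L le_max /logb lexx orbT.
Qed.
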